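(* (Nonconvex objective.) Suppose that $F:\mathbb{R}^d\to\mathbb{R}$ is twice continuously differentiable and bounded below, and that there exists a constant $L>0$ such that $\nabla^2 F(x)\preceq L I$ for all $x\in\mathbb{R}^d$. Let $\{x_k\}$ be the iterates generated by the iteration $x_{k+1}=x_k-\alpha_k\nabla F_{S_k}(x_k)$, $\alpha_k>0$, with any $x_0\in\mathbb{R}^d$, where at each iteration $|S_k|$ is chosen such that the exact variance inner product test (with constant $\theta$) and the exact variance orthogonality test (with constant $\nu$) are satisfied, for any given constants $\theta>0$ and $\nu>0$. Then, if the steplength satisfies $$\alpha_k=\alpha\le\frac{1}{(1+\theta^2+\nu^2)L},$$ we have $$\lim_{k\to\infty}\mathbb{E}[\|\nabla F(x_k)\|^2]=0 .$$ Moreover, for any positive integer $T$, $$\min_{0\le k\le T-1}\mathbb{E}[\|\nabla F(x_k)\|^2]\le\frac{2}{\alpha T}\,(F(x_0)-F_{min}),$$ where $F_{min}$ is a lower bound on $F$ in $\mathbb{R}^d$.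
   Context: Setting. $F(x)=\mathbb{E}_{(z,y)\sim P}[f(x;z,y)]$ is the expected risk on $\mathbb{R}^d$, where $f$ is smooth in $x$ and $P$ is a probability distribution; $F_i(x)=f(x;z^i,y^i)$, where $(z^i,y^i)$ are random draws from $P$. For each fixed $x$, $\mathbb{E}[\nabla F_i(x)]=\nabla F(x)$ and $\mathbb{E}[\|\nabla F_i(x)\|^2]<\infty$, where $\mathbb{E}$ is over the draw $i$. The norm $\|\cdot\|$ is the $\ell_2$ norm, and $A\preceq B$ means that $B-A$ is symmetric positive semidefinite. Sampled gradient. At iterate $x_k$ a finite nonempty sample $S_k$ is drawn and $\nabla F_{S_k}(x_k)=\frac{1}{|S_k|}\sum_{i\in S_k}\nabla F_i(x_k)$. The size $|S_k|\ge 1$ is determined by the history (the starting point $x_0$, which is deterministic, and the samples $S_0,\dots,S_{k-1}$); given its size, $S_k$ consists of i.i.d. draws from $P$ independent of that history. Expectations. In the conclusions, $\mathbb{E}$ is the total expectation over all samples drawn. All expectations appearing are assumed to be well defined and finite. Exact variance inner product test (constant $\theta>0$) at $x_k$: $$\frac{\mathbb{E}\left[\left(\nabla F_i(x_k)^T\nabla F(x_k)-\|\nabla F(x_k)\|^2\right)^2\right]}{|S_k|}\le\theta^2\|\nabla F(x_k)\|^4 .$$ Exact variance orthogonality test (constant $\nu>0$) at $x_k$: $$\frac{\mathbb{E}\left[\left\|\nabla F_i(x_k)-\frac{\nabla F_i(x_k)^T\nabla F(x_k)}{\|\nabla F(x_k)\|^2}\nabla F(x_k)\right\|^2\right]}{|S_k|}\le\nu^2\|\nabla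 F(x_k)\|^2 .$$ In both tests the expectation is over the random draw $i$ (that is, $(z^i,y^i)\sim P$) with $x_k$ held fixed. If $\nabla F(x_k)=0$, the projection term $\frac{\nabla F_i(x_k)^T\nabla F(x_k)}{\|\nabla F(x_k)\|^2}\nabla F(x_k)$ is interpreted as $0$. *)

(* Defs.v *)
From HB Require Import structures.
From mathcomp Require Export all_boot all_order all_algebra.
From mathcomp Require Export all_classical all_reals all_analysis.
Export Order.TTheory GRing.Theory Num.Theory.
Export numFieldNormedType.Exports.

Set Implicit Arguments.
Unset Strict Implicit.
Unset Printing Implicit Defensive.

Local Open Scope classical_set_scope.
Local Open Scope ring_scope.

Section Euclidean.
Context {R : realType} {d : nat}.
Implicit Types (u v x : 'rV[R]_d) (A B : 'M[R]_d).

Definition dotp u v : R := (u *m v^T) 0 0.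

(* The library norm on 'rV[R]_d is the sup norm, hence this definition.  The
   topology, and with it differentiability and continuity, is the same. *)
Definition l2norm v : R := Num.sqrt (dotp v v).

Definition psd A := A^T = A /\ forall v, 0 <= dotp (v *m A) v.

Definition loewner_le A B := psd (B - A).

Definition grad (F : 'rV[R]_d -> R) x : 'rV[R]_d :=
  \row_j 'D_(delta_mx 0 j) F x.

Definition hessian (F : 'rV[R]_d -> R) x : 'M[R]_d := jacobian (grad F) x.

Definition twice_continuously_differentiable (F : 'rV[R]_d -> R) :=
  [/\ forall x, differentiable F x,
      forall x, differentiable (grad F) x
    & continuous (hessian F)].

End Euclidean.

(* [f x xi] is the loss at [x] for the data point [xi = (z, y)], so that
   [grad (f^~ xi) x] is the gradient of a randomly drawn F_i when [xi] has
   law [P]. *)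
Section Tests.
Context {R : realType} {d : nat} {dD : measure_display} {D : measurableType dD}.
Variables (P : probability D R) (f : 'rV[R]_d -> D -> R) (F : 'rV[R]_d -> R).

(* A sample is a sequence rather than a set, since i.i.d. draws may repeat. *)
Definition sample_grad (s : seq D) (x : 'rV[R]_d) : 'rV[R]_d :=
  (size s)%:R^-1 *: \sum_(xi <- s) grad (f^~ xi) x.

Definition inner_product_test (theta : R) (x : 'rV[R]_d) (n : nat) : Prop :=
  ('E_P[fun xi : D =>
      ((dotp (grad (f^~ xi) x) (grad F x) - l2norm (grad F x) ^+ 2) ^+ 2)%R]
    / n%:R%:E <= (theta ^+ 2 * l2norm (grad F x) ^+ 4)%R%:E)%E.

(* When [grad F x = 0] the projection term is [0 *: 0 = 0], as intended. *)
Definition orthogonality_test (nu : R) (x : 'rV[R]_d) (n : nat) : Prop :=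
  ('E_P[fun xi : D =>
      (l2norm (grad (f^~ xi) x
              - (dotp (grad (f^~ xi) x) (grad F x) / l2norm (grad F x) ^+ 2)
                *: grad F x) ^+ 2)%R]
    / n%:R%:E <= (nu ^+ 2 * l2norm (grad F x) ^+ 2)%R%:E)%E.

End Tests.

Section Sampling.
Context {R : realType} {dO dD : measure_display}
  {Omega : measurableType dO} {D : measurableType dD}.

(* The event that the random sample [s] has more than [j] elements and its
   [j]-th element lies in [B]; with [B = setT] it is [j < size s]. *)
Definition draw_event (s : Omega -> seq D) (j : nat) (B : set D) : set Omega :=
  [set w | exists2 xi, onth (s w) j = Some xi & B xi].

Definition random_sample (s : Omega -> seq D) : Prop :=
  forall j B, measurable B -> measurable (draw_event s j B).

(* The sigma-algebra generated by S_0, ..., S_(k-1), sizes included. *)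
Definition history (S : nat -> Omega -> seq D) (k : nat) : set (set Omega) :=
  <<s [set A | exists i j B,
         [/\ (i < k)%N, measurable B & A = draw_event (S i) j B]] >>.

Definition size_determined_by (H : set (set Omega)) (s : Omega -> seq D) :=
  forall n, H [set w | size (s w) = n].

(* Conditionally on [H] and on its size being [n], [s] has law P^n. *)
Definition iid_given_size (Pr : probability Omega R) (P : probability D R)
    (H : set (set Omega)) (s : Omega -> seq D) : Prop :=
  forall (n : nat) (A : set Omega) (B : 'I_n -> set D),
    H A -> (forall j, measurable (B j)) ->
    (Pr (A `&` [set w | size (s w) = n]
           `&` \bigcap_(j in [set: 'I_n]) draw_event s j (B j))
     = Pr (A `&` [set w | size (s w) = n]) * \prod_(j < n) P (B j))%E.

End Sampling.

(* Main.v *)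
From HB Require Import structures.
Require Import Defs.
From mathcomp Require Import measurable_realfun ring lra.

Set Implicit Arguments.
Unset Strict Implicit.
Unset Printing Implicit Defensive.

Local Open Scope classical_set_scope.
Local Open Scope ring_scope.

(** The upper bound on the Hessian gives the descent inequality
    [F (x + v) <= F x + <grad F x, v> + L/2 |v|^2].  With [v = - alpha g], [g]
    the averaged sampled gradient at the iterate [x], two facts about [g] given
    the history are needed.  It is unbiased, so the linear term contributes
    [- alpha |grad F x|^2].  And its second moment is at most
    [(1 + theta^2 + nu^2) |grad F x|^2]: writing [m] for the second moment of a
    single draw, averaging [n] independent draws gives
    [E |g|^2 = m / n + (1 - 1/n) |grad F x|^2], while splitting a draw into its
    component along [grad F x] and the orthogonal rest turns the two variance
    tests into [m - |grad F x|^2 <= n (theta^2 + nu^2) |grad F x|^2].  For the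
    given steplengths the quadratic term therefore costs at most half of what
    the linear term gains, and
    [E (F x_(k+1)) + alpha/2 E |grad F x_k|^2 <= E (F x_k)].
    Summed over [k] and compared with the lower bound [Fmin], this bounds the
    series of the [E |grad F x_k|^2] by [2/alpha (F x0 - Fmin)], which gives
    both conclusions.

    Conditional expectations are replaced by Fubini's theorem.  On the event
    that the sample has size [n], any one draw is independent of the history,
    and of the history together with any other draw; this says that certain
    joint laws are products, and [disintegration] turns it into iterated
    integrals ([integral_sample_mean_sqr]).  The iterates enter only as
    functions measurable for the sigma-algebra of the past draws
    ([measurable_iterates]).  That in turn requires the gradient of the loss to
    be jointly measurable in the point and the datum, although only
    differentiability in the point and measurability in the datum are given
    ([measurable_grad_coord]).  [one_step_decrease] is the estimate for one
    iteration at a fixed sample size, and [expected_decrease] sums it over the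
    sizes. *)

(** * Euclidean inner product *)

Section Dot.
Context {R : realType} {d : nat}.
Implicit Types u v w : 'rV[R]_d.

Lemma dotpE u v : dotp u v = \sum_j u 0 j * v 0 j.
Proof. by rewrite /dotp mxE; apply: eq_bigr => j _; rewrite mxE. Qed.

Lemma dotpC u v : dotp u v = dotp v u.
Proof. by rewrite !dotpE; apply: eq_bigr => j _; rewrite mulrC. Qed.

Lemma dotpDl u v w : dotp (u + v) w = dotp u w + dotp v w.
Proof. by rewrite /dotp mulmxDl mxE. Qed.

Lemma dotpZl a u v : dotp (a *: u) v = a * dotp u v.
Proof. by rewrite /dotp -scalemxAl mxE. Qed.

Lemma dotpDr u v w : dotp u (v + w) = dotp u v + dotp u w.
Proof. by rewrite dotpC dotpDl !(dotpC u). Qed.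

Lemma dotpZr a u v : dotp u (a *: v) = a * dotp u v.
Proof. by rewrite dotpC dotpZl dotpC. Qed.

Lemma dotpNr u v : dotp u (- v) = - dotp u v.
Proof. by rewrite -scaleN1r dotpZr mulN1r. Qed.

Lemma dotp_ge0 u : 0 <= dotp u u.
Proof. by rewrite dotpE sumr_ge0// => j _; rewrite -expr2 sqr_ge0. Qed.

Lemma l2norm2 u : l2norm u ^+ 2 = dotp u u.
Proof. by rewrite /l2norm sqr_sqrtr// dotp_ge0. Qed.

Lemma dotp_eq0 u : dotp u u = 0 -> u = 0.
Proof.
rewrite dotpE => /eqP; rewrite psumr_eq0; last first.
  by move=> j _; rewrite -expr2 sqr_ge0.
move=> /allP u0; apply/rowP => j; rewrite mxE.
have /(_ (mem_index_enum _)) := u0 j.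
by rewrite /= mulf_eq0 orbb => /eqP.
Qed.

Lemma sqr_coord_le_dotp u j : u 0 j ^+ 2 <= dotp u u.
Proof.
rewrite dotpE (bigD1 j)//= -expr2 lerDl sumr_ge0// => i _.
by rewrite -expr2 sqr_ge0.
Qed.

End Dot.

(** * The descent inequality *)

Lemma is_derive_line (R : realType) (n : nat) (W : normedModType R)
    (f : 'rV[R]_n -> W) (x v : 'rV[R]_n) (t : R) :
  differentiable f (x + t *: v) ->
  is_derive t 1 (fun s : R => f (x + s *: v)) ('d f (x + t *: v) v).
Proof.
move=> df.
have dl : is_diff (t : R^o) (fun s : R^o => x + s *: v) ( *:%R ^~ v).
  have -> : (fun s : R^o => x + s *: v) = cst x \+ ( *:%R ^~ v) by [].
  have h := is_diffD (is_diff_cst x (t : R^o)) (is_diff_scalel t v).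
  by apply: is_diff_eq h _; apply/funext => s /=; rewrite add0r.
case: (dl) => ddl _.
have dc : differentiable (f \o (fun s : R^o => x + s *: v)) (t : R^o).
  exact: differentiable_comp.
apply: DeriveDef; first exact: diff_derivable.
by rewrite deriveE// diff_comp//= diff_val scale1r.
Qed.

Section Descent.
Context {R : realType} {d : nat}.
Implicit Types (F : 'rV[R]_d -> R) (u v x : 'rV[R]_d).

Lemma C2_continuous F : twice_continuously_differentiable F -> continuous F.
Proof. by case=> dF _ _ v; exact: differentiable_continuous. Qed.

Lemma C2_continuous_grad_coord F j : twice_continuously_differentiable F ->
  continuous (fun v => grad F v 0 j).
Proof.
case=> _ dgF _ v.
apply: (@continuous_comp _ _ _ (grad F) (fun M : 'rV[R]_d => M 0 j)).
  exact: differentiable_continuous.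
exact: coord_continuous.
Qed.

Lemma diff_dotp_grad F x v : differentiable F x ->
  'd F x v = dotp (grad F x) v.
Proof.
move=> dF; rewrite dotpE {1}(row_sum_delta v) linear_sum; apply: eq_bigr => j _.
by rewrite linearZ/= mxE deriveE// mulrC.
Qed.

Lemma diff_grad_hessian F x v :
  'd (grad F) x v = v *m hessian F x.
Proof. by rewrite /hessian /jacobian mul_rV_lin1. Qed.

Lemma hessian_bound F L x v : loewner_le (hessian F x) L%:M ->
  dotp (v *m hessian F x) v <= L * dotp v v.
Proof.
move=> [_ /(_ v)]; rewrite mulmxBr dotpDl mul_mx_scalar dotpZl.
by rewrite -mulmxN dotpC mulmxN dotpNr subr_ge0 dotpC.
Qed.

(** Along the segment from [x] to [x + v], the error
    [psi t = F (x + t v) - c t - L/2 |v|^2 t^2] of the quadratic model satisfies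
    [psi'' <= 0] by the Hessian bound and [psi' 0 = 0], hence [psi 1 <= psi 0]. *)
Lemma descent_inequality F L x v :
  twice_continuously_differentiable F ->
  (forall u, loewner_le (hessian F u) L%:M) ->
  F (x + v) <= F x + dotp (grad F x) v + L / 2 * dotp v v.
Proof.
move=> [dF dgF _] hF.
pose q := dotp v v; pose c := dotp (grad F x) v.
pose psi' (t : R) := dotp (grad F (x + t *: v)) v - (c + L * q * t).
pose psi (t : R) := F (x + t *: v) - (c * t + L / 2 * q * t ^+ 2).
have dpsi (t : R) : is_derive t 1 psi (psi' t).
  have h1 := is_derive_line (dF (x + t *: v)).
  rewrite diff_dotp_grad// in h1.
  have h2 : is_derive t 1 (fun t => c * t + L / 2 * q * t ^+ 2)
      (c + L * q * t).
    by apply: is_derive_eq; rewrite /GRing.scale/=; field.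
  exact: (is_deriveB h1 h2).
have dpsi' (t : R) : is_derive t 1 psi'
    (dotp (v *m hessian F (x + t *: v)) v - L * q).
  have h1 := is_derive_line (dgF (x + t *: v)).
  rewrite diff_grad_hessian in h1.
  have h2 : is_derive t 1 (fun s : R => dotp (grad F (x + s *: v)) v)
      (dotp (v *m hessian F (x + t *: v)) v).
    have hj j : is_derive t 1 (fun s : R => grad F (x + s *: v) 0 j * v 0 j)
        ((v *m hessian F (x + t *: v)) 0 j * v 0 j).
      have [h1d h1v] := h1.
      have hc : is_derive t 1 (fun s : R => grad F (x + s *: v) 0 j)
          ((v *m hessian F (x + t *: v)) 0 j).
        apply: DeriveDef; first exact: (derivable_mxP _ _ _).1.
        by rewrite -h1v derive_mx// mxE.
      apply: is_derive_eq (is_deriveM hc (is_derive_cst (v 0 j) t 1)) _.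
      by rewrite /GRing.scale/= /cst; ring.
    rewrite dotpE.
    rewrite (_ : (fun s => _) =
        \sum_j (fun s => grad F (x + s *: v) 0 j * v 0 j)); last first.
      by apply/funext => s; rewrite fct_sumE dotpE.
    exact: is_derive_sum.
  have h3 : is_derive t 1 (fun t => c + L * q * t) (L * q).
    by apply: is_derive_eq; rewrite /GRing.scale/=; ring.
  exact: (is_deriveB h2 h3).
have cont g (g' : R -> R) : (forall t : R, is_derive t 1 g (g' t)) ->
    {within `[0:R, 1:R], continuous g}.
  move=> dg; apply: continuous_subspaceT => t.
  apply: differentiable_continuous; apply/derivable1_diffP.
  by have [] := dg t.
have mono g (g' : R -> R) : (forall t : R, is_derive t 1 g (g' t)) ->
    (forall t : R, 0 <= t <= 1 -> g' t <= 0) ->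
    forall t, 0 <= t <= 1 -> g t <= g 0.
  move=> dg g'0 t /andP[t0 t1].
  apply: (@ler0_derive1_nincr _ g 0 1) => //; last first.
  - exact: (cont g g' dg).
  - move=> s; rewrite in_itv/= => /andP[s0 s1].
    by have [_ ds] := dg s; rewrite derive1E ds g'0// !ltW.
have p'0 (t : R) : 0 <= t <= 1 -> psi' t <= 0.
  move=> t01; have := mono _ _ dpsi' _ t t01.
  rewrite /psi' scale0r addr0 mulr0 addr0 subrr; apply => s _.
  by rewrite subr_le0; exact: hessian_bound.
have /(_ 1) := mono _ _ dpsi p'0; rewrite /psi ler01 lexx => /(_ isT).
rewrite scale0r scale1r addr0; rewrite -/c -/q; lra.
Qed.

(** The step [v = - grad F x / L] minimizes the right-hand side of the descent
    inequality and cannot bring [F] below [Fmin].  Integrability of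
    [|grad F x_k|^2] will follow from that of [F x_k] in this way. *)
Lemma sqr_grad_le_gap F L Fmin x : 0 < L ->
  twice_continuously_differentiable F ->
  (forall u, loewner_le (hessian F u) L%:M) ->
  (forall u, Fmin <= F u) ->
  dotp (grad F x) (grad F x) <= 2 * L * (F x - Fmin).
Proof.
move=> L0 FC2 FL Fm.
have := descent_inequality x (- L^-1 *: grad F x) FC2 FL.
have := Fm (x + - L^-1 *: grad F x).
rewrite !dotpZr !dotpZl; set q := dotp _ _ => h1 h2.
have := le_trans h1 h2.
have -> : F x + - L^-1 * q + L / 2 * (- L^-1 * (- L^-1 * q)) =
   F x - q / (2 * L) by field; rewrite gt_eqF.
by move=> h; rewrite mulrC -ler_pdivrMr ?mulr_gt0//; lra.
Qed.
End Descent.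

(** * Joint measurability of the gradient *)

Lemma measurable_fun_countable_select d1 d2 (T : measurableType d1)
    (E : measurableType d2) (I : countType) (N : T -> I) (h : I -> T -> E) :
  (forall i, measurable [set t | N t = i]) ->
  (forall i, measurable_fun setT (h i)) ->
  measurable_fun setT (fun t => h (N t) t).
Proof.
move=> mN mh _ B mB; rewrite setTI.
rewrite (_ : _ @^-1` B = \bigcup_i ([set t | N t = i] `&` h i @^-1` B)).
  apply: countable_bigcupT_measurable; first exact: countableP.
  move=> i; apply: measurableI => //.
  by rewrite -[X in measurable X]setTI; exact: mh.
apply/seteqP; split => [t Bt|t [i _ [<-]]//].
by exists (N t).
Qed.

Lemma translation_continuous (R : realType) (d : nat) (c : 'rV[R]_d) :
  continuous (fun v : 'rV[R]_d => c + v).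
Proof.
move=> v; apply: (continuousD (f := cst c) (g := id)); last by [].
exact: cst_continuous.
Qed.

Section Caratheodory.
Context {R : realType} {d : nat}.

Definition grid_index (n : nat) (u : 'rV[R]_d) : 'rV[int]_d :=
  \row_j Num.floor (n.+1%:R * u 0 j).
Definition grid_point (n : nat) (q : 'rV[int]_d) : 'rV[R]_d :=
  \row_j ((q 0 j)%:~R / n.+1%:R).

Lemma grid_point_cvg (u : 'rV[R]_d) :
  (fun n => grid_point n (grid_index n u)) @ \oo --> u.
Proof.
apply/cvgrPdist_le => /= e e0.
have := near_infty_natSinv_lt (PosNum e0).
apply: filterS => n /= /ltW ne.
rewrite /Num.Def.normr/= mx_normrE (bigmax_le _ (ltW e0))//= => -[i j] _.
rewrite !mxE/= ord1; apply: le_trans ne.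
set y := u 0 j; have n0 : (0 : R) < n.+1%:R by [].
have /andP[h1 h2] := floor_itv (n.+1%:R * y).
rewrite ger0_norm ?subr_ge0 ?ler_pdivrMr//; last by rewrite (mulrC y).
rewrite lerBlDr ltW// -(ltr_pM2r n0) mulrDl mulVf ?divfK ?gt_eqF//.
by rewrite mulrC addrC; move: h2; rewrite intrD.
Qed.

Context d1 (T : measurableType d1) (X : T -> 'rV[R]_d).
Hypothesis mX : forall j, measurable_fun setT (fun t => X t 0 j).

Lemma measurable_grid_index n q : measurable [set t | grid_index n (X t) = q].
Proof.
rewrite (_ : [set _ | _] = \bigcap_(j in [set: 'I_d])
   (fun t => X t 0 j) @^-1`
     `[((q 0 j)%:~R / n.+1%:R : R), ((q 0 j + 1)%:~R / n.+1%:R : R)[%classic).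
  apply: fin_bigcap_measurable; first exact: finite_finset.
  move=> j _; rewrite -[X in measurable X]setTI; apply: mX => //.
have n0 : (0 : R) < n.+1%:R by [].
apply/seteqP; split => t /=.
  move=> <- j _ /=; rewrite in_itv/= mxE ler_pdivrMr// ltr_pdivlMr//.
  by rewrite mulrC floor_itv.
move=> h; apply/rowP => j; rewrite mxE; apply: floor_def.
have := h j I; rewrite /= in_itv/= ler_pdivrMr// ltr_pdivlMr//.
by rewrite mulrC.
Qed.

(** Rounding the point to a grid of mesh [1 / n.+1] leaves countably many
    points, where measurability in the second variable suffices; continuity in
    the first variable then lets the mesh tend to [0]. *)
Lemma measurable_caratheodory d2 (D : measurableType d2)
    (phi : 'rV[R]_d -> D -> R) :
  (forall xi, continuous (phi^~ xi)) ->
  (forall u, measurable_fun setT (phi u)) ->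
  measurable_fun setT (fun p : T * D => phi (X p.1) p.2).
Proof.
move=> cphi mphi.
pose h n (p : T * D) := phi (grid_point n (grid_index n (X p.1))) p.2.
apply: (measurable_fun_cvg (h := h)) => [n|p _].
  apply: (@measurable_fun_countable_select _ _ (T * D)%type R _
    (fun p => grid_index n (X p.1)) (fun q p => phi (grid_point n q) p.2)).
    move=> q; rewrite -[X in measurable X]setTI.
    exact: (@measurable_fst _ _ T D measurableT _ (measurable_grid_index n q)).
  by move=> q; exact: measurableT_comp.
apply: (@cvg_comp _ _ _ (fun n => grid_point n (grid_index n (X p.1)))
  (phi^~ p.2)).
  exact: grid_point_cvg.
exact: cphi.
Qed.

Lemma measurable_continuous_comp (phi : 'rV[R]_d -> R) :
  continuous phi -> measurable_fun setT (fun t => phi (X t)).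
Proof.
move=> cphi.
have := @measurable_caratheodory _ unit (fun u _ => phi u) (fun _ => cphi).
move=> /(_ (fun u => measurable_cst _)) m.
rewrite (_ : (fun t => _) = (fun p : T * unit => phi (X p.1)) \o pair^~ tt)//.
by apply: (measurableT_comp m); exact: measurable_fun_pair.
Qed.

(** A partial derivative is the limit of difference quotients along the steps
    [1 / n.+1], and each quotient is continuous in the point. *)
Lemma measurable_grad_coord d2 (D : measurableType d2)
    (f : 'rV[R]_d -> D -> R) :
  (forall xi u, differentiable (f^~ xi) u) ->
  (forall u, measurable_fun setT (f u)) ->
  forall j, measurable_fun setT (fun p : T * D => grad (f^~ p.2) (X p.1) 0 j).
Proof.
move=> df mf j.
pose phi (n : nat) (u : 'rV[R]_d) (xi : D) : R :=
  (harmonic n)^-1 * (f (harmonic n *: delta_mx 0 j + u) xi - f u xi).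
have cf xi : continuous (f^~ xi) by move=> u; exact: differentiable_continuous.
apply: (measurable_fun_cvg (h := fun n (p : T * D) => phi n (X p.1) p.2)).
  move=> n; apply: measurable_caratheodory.
    move=> xi u; rewrite /phi /continuous_at.
    apply: cvgMl_tmp; first exact: (nbhs_filter u).
    apply: cvgB; [exact: (nbhs_filter u)| |exact: cf].
    apply: (cvg_comp (fun v => harmonic n *: delta_mx 0 j + v) (f^~ xi) _
              (@cf xi _)).
    exact: translation_continuous.
  by move=> u; apply: measurable_funM => //; exact: measurable_funB.
move=> [t xi] _ /=; rewrite mxE.
have /cvg_ex[l hl] :=
  @diff_derivable _ _ _ (f^~ xi) (X t) (delta_mx 0 j) (df xi (X t)).
have -> : 'D_(delta_mx 0 j) (f^~ xi) (X t) = l by exact: cvg_lim.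
have hh : @harmonic R @ \oo --> 0^'.
  move=> A /cvg_harmonic hA.
  apply: (@filterS nat \oo _ [set n | harmonic n != 0 :> R -> A (harmonic n)]).
    by move=> n; apply; apply: lt0r_neq0; exact: harmonic_gt0.
  exact: hA.
exact: (cvg_comp _ _ hh hl).
Qed.
End Caratheodory.

Lemma measurable_grad_coord_at (R : realType) (d : nat) dD
    (D : measurableType dD) (f : 'rV[R]_d -> D -> R) (v : 'rV[R]_d) :
  (forall xi u, differentiable (f^~ xi) u) ->
  (forall u, measurable_fun setT (f u)) ->
  forall j, measurable_fun setT (fun xi => grad (f^~ xi) v 0 j).
Proof.
move=> df mf j.
have m := @measurable_grad_coord R d _ D (fun=> v) (fun j => measurable_cst _)
  _ D f df mf j.
exact: (measurableT_comp m (measurable_fun_pair (@measurable_id _ _ _)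
  (@measurable_id _ _ _))).
Qed.

Lemma measurable_dotp (R : realType) (d : nat) dE (E : measurableType dE)
    (u v : E -> 'rV[R]_d) :
  (forall j, measurable_fun setT (fun y => u y 0 j)) ->
  (forall j, measurable_fun setT (fun y => v y 0 j)) ->
  measurable_fun setT (fun y => dotp (u y) (v y)).
Proof.
move=> mu mv; under eq_fun do rewrite dotpE.
by apply: measurable_sum => j; exact: measurable_funM.
Qed.

(** * Independence and iterated integrals *)

Lemma measurable_preimageT d1 d2 (T : measurableType d1) (E : measurableType d2)
    (X : T -> E) (A : set E) :
  measurable_fun setT X -> measurable A -> measurable (X @^-1` A).
Proof. by move=> mX mA; rewrite -[X in measurable X]setTI; exact: mX. Qed.

(** The image measure.  Its measure structure depends on the measurability of
    [X], which is an argument so that the structure can be inferred from the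
    term. *)
Definition law d1 d2 (Omega : measurableType d1) (T : measurableType d2)
    (R : realType) (mu : set Omega -> \bar R) (X : Omega -> T)
    (mX : measurable_fun setT X) : set T -> \bar R := pushforward mu X.

Section law.
Context d1 d2 (Omega : measurableType d1) (T : measurableType d2)
  (R : realType) (mu : {finite_measure set Omega -> \bar R}) (X : Omega -> T).
Hypothesis mX : measurable_fun setT X.

Let pf : {measure set T -> \bar R} :=
  measure_function_pushforward__canonical__measure_function_Measure mu mX.

HB.instance Definition _ := isMeasure.Build _ _ _ (law mu mX)
  (measure0 pf) (measure_ge0 pf) (@measure_semi_sigma_additive _ _ _ pf).

Let law_fin : fin_num_fun (law mu mX).
Proof. by move=> A mA; apply: fin_num_measure; exact: measurable_preimageT. Qed.

HB.instance Definition _ := Measure_isFinite.Build _ _ _ (law mu mX) law_fin.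
End law.

(** [Y] is independent of [X] and has law [P].  The total mass of [mu] need not
    be [1]: [mu] will be a probability restricted to an event. *)
Definition independent_of_law d1 d2 d3 (Omega : measurableType d1)
    (T : measurableType d2) (D : measurableType d3) (R : realType)
    (mu : set Omega -> \bar R) (P : set D -> \bar R)
    (X : Omega -> T) (Y : Omega -> D) :=
  forall A B, measurable A -> measurable B ->
    mu (X @^-1` A `&` Y @^-1` B) = (mu (X @^-1` A) * P B)%E.

Section disintegration.
Context d1 d2 d3 (Omega : measurableType d1) (T : measurableType d2)
  (D : measurableType d3) (R : realType)
  (mu : {finite_measure set Omega -> \bar R}) (P : probability D R)
  (X : Omega -> T) (Y : Omega -> D).
Hypothesis mX : measurable_fun setT X.
Hypothesis mY : measurable_fun setT Y.
Hypothesis indep : independent_of_law mu P X Y.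

Let mXY : measurable_fun setT (fun w => (X w, Y w)).
Proof. exact: measurable_fun_pair. Qed.

Lemma law_pair C : measurable C -> law mu mXY C = (law mu mX \x P)%E C.
Proof.
move=> mC; apply/esym.
exact: (@product_measure_unique _ _ _ _ _ (law mu mX) P (law mu mXY)).
Qed.

Lemma ge0_disintegration (phi : T * D -> \bar R) :
  measurable_fun setT phi -> (forall p, 0 <= phi p)%E ->
  (\int[mu]_w phi (X w, Y w) = \int[mu]_w \int[P]_y phi (X w, y))%E.
Proof.
move=> mphi phi0.
transitivity (\int[law mu mXY]_p phi p)%E.
  by rewrite ge0_integral_pushforward// => p _.
transitivity (\int[(law mu mX \x P)%E]_p phi p)%E.
  by apply: eq_measure_integral => A mA _; exact: law_pair.
rewrite fubini_tonelli1// ge0_integral_pushforward//.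
  exact: measurable_fun_fubini_tonelli_F.
by move=> t _; apply: integral_ge0.
Qed.

Lemma disintegration (phi : T * D -> \bar R) :
  measurable_fun setT phi ->
  mu.-integrable setT (fun w => phi (X w, Y w)) ->
  (\int[mu]_w phi (X w, Y w) = \int[mu]_w \int[P]_y phi (X w, y))%E.
Proof.
move=> mphi iphi.
have i2 : (law mu mX \x P)%E.-integrable setT phi.
  apply/integrableP; split => //.
  rewrite (eq_measure_integral (law mu mXY)); last first.
    by move=> A mA _; apply/esym; exact: law_pair.
  rewrite ge0_integral_pushforward//; last exact: measurableT_comp.
  by case/integrableP : iphi.
transitivity (\int[law mu mXY]_p phi p)%E.
  by rewrite integral_pushforward.
transitivity (\int[(law mu mX \x P)%E]_p phi p)%E.
  by apply: eq_measure_integral => A mA _; exact: law_pair.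
rewrite -integral12_prod_meas1// integral_pushforward//.
  exact: (measurable_fubini_F i2).
have := integrable_fubini_F i2.
move=> /integrableP[m1]; rewrite ge0_integral_pushforward//; last first.
  exact: measurableT_comp.
move=> l; apply/integrableP; split => //.
exact: measurableT_comp.
Qed.

End disintegration.

(** For a fixed event on [Y], both sides of the product formula are measures of
    the event on the pair [(X, Z)].  On rectangles both are given by the
    hypothesis, and equal the same product measure. *)
Lemma independent_of_law_pair d1 d2 d3 (Omega : measurableType d1)
    (T : measurableType d2) (D : measurableType d3) (R : realType)
    (mu : {finite_measure set Omega -> \bar R}) (P : probability D R)
    (X : Omega -> T) (Y Z : Omega -> D) :
  measurable_fun setT X -> measurable_fun setT Y -> measurable_fun setT Z ->
  (forall A B C, measurable A -> measurable B -> measurable C ->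
    mu (X @^-1` A `&` Y @^-1` B `&` Z @^-1` C) =
      (mu (X @^-1` A) * P B * P C)%E) ->
  independent_of_law mu P (fun w => (X w, Z w)) Y.
Proof.
move=> mX mY mZ tri C B mC mB.
have mXZ : measurable_fun setT (fun w => (X w, Z w)).
  exact: measurable_fun_pair.
have mYB := measurable_preimageT mY mB.
pose muB := mrestr mu mYB.
have muBX A : measurable A -> muB (X @^-1` A) = (mu (X @^-1` A) * P B)%E.
  move=> mA; have := tri A B setT mA mB measurableT.
  by rewrite preimage_setT setIT probability_setT mule1.
have muXZ A A' : measurable A -> measurable A' ->
    mu (X @^-1` A `&` Z @^-1` A') = (mu (X @^-1` A) * P A')%E.
  move=> mA mA'; have := tri A setT A' mA measurableT mA'.
  by rewrite preimage_setT setIT probability_setT mule1.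
have PB : P B = (fine (P B))%:E by rewrite fineK// fin_num_measure.
have PB0 : 0 <= fine (P B) by rewrite fine_ge0.
pose m2 := mscale (NngNum PB0) (law mu mXZ).
have lB A : measurable A -> law muB mX A = (mu (X @^-1` A) * P B)%E.
  exact: muBX.
have e1 : (law muB mX \x P)%E C = law muB mXZ C.
  apply: product_measure_unique => // A A' mA mA'.
  transitivity (mu (X @^-1` A) * P B * P A')%E; last first.
    by congr (_ * _)%E; exact/esym/lB.
  by rewrite -(tri A B A')// setIAC.
have m2E A : m2 A = (P B * mu ((fun w => (X w, Z w)) @^-1` A))%E.
  by rewrite /m2 /mscale/= -PB.
have e2 : (law muB mX \x P)%E C = m2 C.
  apply: product_measure_unique => // A A' mA mA'.
  transitivity (mu (X @^-1` A) * P B * P A')%E; last first.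
    by congr (_ * _)%E; exact/esym/lB.
  rewrite [LHS]m2E [mu _](muXZ A A')//.
  by rewrite muleA [(P B * _)%E]muleC.
by move: e1; rewrite e2 m2E muleC => ->.
Qed.

(** * First and second moments of a sample mean *)

Lemma integrable_prod_sqr d (T : measurableType d) (R : realType)
    (mu : {measure set T -> \bar R}) (u v : T -> R) :
  measurable_fun setT u -> measurable_fun setT v ->
  mu.-integrable setT (fun x => (u x ^+ 2)%:E) ->
  mu.-integrable setT (fun x => (v x ^+ 2)%:E) ->
  mu.-integrable setT (fun x => (u x * v x)%:E).
Proof.
move=> mu' mv iu iv.
apply: le_integrable (integrableD measurableT iu iv) => //.
  by apply/measurable_EFinP; exact: measurable_funM.
move=> x _; rewrite /= lee_fin normrM.
rewrite (ger0_norm (addr_ge0 (sqr_ge0 _) (sqr_ge0 _))).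
rewrite -(real_normK (num_real (u x))) -(real_normK (num_real (v x))).
have := sqr_ge0 (`|u x| - `|v x|).
have := normr_ge0 (u x); have := normr_ge0 (v x); nra.
Qed.

Section sample_mean.
Context d1 d2 d3 (Omega : measurableType d1) (T : measurableType d2)
  (D : measurableType d3) (R : realType)
  (mu : {finite_measure set Omega -> \bar R}) (P : probability D R)
  (X : Omega -> T) (n : nat) (Y : 'I_n -> Omega -> D).
Hypothesis mX : measurable_fun setT X.
Hypothesis mY : forall i, measurable_fun setT (Y i).
Hypothesis indep1 : forall i, independent_of_law mu P X (Y i).
Hypothesis indep2 : forall i j, i != j ->
  independent_of_law mu P (fun w => (X w, Y j w)) (Y i).
Variables (h : T * D -> R) (b : T -> R).
Hypothesis mh : measurable_fun setT h.
Hypothesis mb : measurable_fun setT b.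
Hypothesis ih : forall t, P.-integrable setT (fun y => (h (t, y))%:E).
Hypothesis hb : forall t, (\int[P]_y (h (t, y))%:E)%E = (b t)%:E.
Hypothesis h2 : (\int[mu]_w \int[P]_y (h (X w, y) ^+ 2)%:E < +oo)%E.
Hypothesis b2 : (\int[mu]_w (b (X w) ^+ 2)%:E < +oo)%E.

Let mpair i : measurable_fun setT (fun w => (X w, Y i w)).
Proof. exact: measurable_fun_pair. Qed.

Let mhi i : measurable_fun setT (fun w => h (X w, Y i w)).
Proof. exact: (measurableT_comp mh (mpair i)). Qed.

Let mbX : measurable_fun setT (fun w => b (X w)).
Proof. exact: measurableT_comp. Qed.

Lemma integral_sample_sqr i : (\int[mu]_w (h (X w, Y i w) ^+ 2)%:E =
  \int[mu]_w \int[P]_y (h (X w, y) ^+ 2)%:E)%E.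
Proof.
apply: (ge0_disintegration mX (mY i) (indep1 i) (phi := fun p => (h p ^+ 2)%:E)).
  by apply/measurable_EFinP; exact: measurable_funX.
by move=> p; rewrite lee_fin sqr_ge0.
Qed.

Let ihi2 i : mu.-integrable setT (fun w => (h (X w, Y i w) ^+ 2)%:E).
Proof.
apply/integrableP; split.
  by apply/measurable_EFinP; exact: measurable_funX.
under eq_integral do rewrite gee0_abs ?lee_fin ?sqr_ge0//.
by rewrite integral_sample_sqr.
Qed.

Let ib2 : mu.-integrable setT (fun w => (b (X w) ^+ 2)%:E).
Proof.
apply/integrableP; split.
  by apply/measurable_EFinP; exact: measurable_funX.
by under eq_integral do rewrite gee0_abs ?lee_fin ?sqr_ge0//.
Qed.

Lemma integral_mean_sample i :
  (\int[mu]_w (b (X w) * h (X w, Y i w))%:E = \int[mu]_w (b (X w) ^+ 2)%:E)%E.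
Proof.
rewrite (disintegration mX (mY i) (indep1 i)
  (phi := fun p => (b p.1 * h p)%:E)); last 2 first.
- apply/measurable_EFinP; apply: measurable_funM => //.
  exact: measurableT_comp.
- exact: integrable_prod_sqr.
apply: eq_integral => w _.
under eq_integral do rewrite /= EFinM.
by rewrite integralZl//= hb -EFinM expr2.
Qed.

(** Integrating out the draw [i] while the pair formed by [X] and the draw [j]
    is fixed replaces the first factor by its mean [b], which leaves a single
    draw. *)
Lemma integral_sample_prod i j : i != j ->
  (\int[mu]_w (h (X w, Y i w) * h (X w, Y j w))%:E =
   \int[mu]_w (b (X w) ^+ 2)%:E)%E.
Proof.
move=> ij; rewrite -(integral_mean_sample j).
rewrite (disintegration (mpair j) (mY i) (indep2 ij)
  (phi := fun p => (h (p.1.1, p.2) * h p.1)%:E)); last 2 first.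
- apply/measurable_EFinP; apply: measurable_funM; last exact: measurableT_comp.
  apply: (measurableT_comp mh); apply: measurable_fun_pair => //.
  exact: measurableT_comp.
- exact: (integrable_prod_sqr (mhi i) (mhi j)).
apply: eq_integral => w _ /=.
under eq_integral do rewrite /= EFinM.
by rewrite integralZr//= hb -EFinM.
Qed.

Definition sample_mean w : R := n%:R^-1 * \sum_(i < n) h (X w, Y i w).

Hypothesis n0 : (0 < n)%N.

Lemma integrable_mean_sample_mean :
  mu.-integrable setT (fun w => (b (X w) * sample_mean w)%:E).
Proof.
rewrite (_ : (fun w => _) = (fun w =>
    n%:R^-1%:E * \sum_(i < n) (b (X w) * h (X w, Y i w))%:E)%E).
  apply: integrableZl => //; apply: integrable_sum => // i _.
  exact: integrable_prod_sqr.
by apply/funext => w; rewrite sumEFin -EFinM -mulr_sumr mulrCA.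
Qed.

Lemma integral_mean_sample_mean :
  (\int[mu]_w (b (X w) * sample_mean w)%:E = \int[mu]_w (b (X w) ^+ 2)%:E)%E.
Proof.
under eq_integral do rewrite /sample_mean mulrCA mulr_sumr EFinM -sumEFin.
rewrite integralZl//; last first.
  by apply: integrable_sum => // i _; exact: integrable_prod_sqr.
rewrite integral_sum//; last by move=> i; exact: integrable_prod_sqr.
under eq_bigr do rewrite integral_mean_sample.
have /fineK <- := integrable_fin_num measurableT ib2.
rewrite sumEFin -EFinM sumr_const card_ord -[X in _ * X]mulr_natl mulKf//.
by rewrite pnatr_eq0 -lt0n.
Qed.

Let sqrE w : (sample_mean w ^+ 2)%:E =
  ((n%:R^-1 ^+ 2)%:E *
     \sum_(i < n) \sum_(j < n) (h (X w, Y i w) * h (X w, Y j w))%:E)%E.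
Proof.
rewrite /sample_mean exprMn EFinM; congr (_ * _)%E.
under [RHS]eq_bigr do rewrite sumEFin -mulr_sumr.
by rewrite sumEFin -mulr_suml expr2.
Qed.

Lemma integrable_sample_mean_sqr :
  mu.-integrable setT (fun w => (sample_mean w ^+ 2)%:E).
Proof.
rewrite (funext sqrE); apply: integrableZl => //; apply: integrable_sum => // i _.
apply: integrable_sum => // j _; exact: integrable_prod_sqr.
Qed.

(** Of the [n ^ 2] products of two draws, the [n] diagonal ones contribute the
    second moment and the others the squared mean. *)
Lemma integral_sample_mean_sqr :
  (\int[mu]_w (sample_mean w ^+ 2)%:E =
   n%:R^-1%:E * \int[mu]_w \int[P]_y (h (X w, y) ^+ 2)%:E +
   (1 - n%:R^-1)%:E * \int[mu]_w (b (X w) ^+ 2)%:E)%E.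
Proof.
have ihh i j :
    mu.-integrable setT (fun w => (h (X w, Y i w) * h (X w, Y j w))%:E).
  exact: integrable_prod_sqr.
rewrite (eq_integral _ _ (fun w _ => sqrE w)) integralZl//; last first.
  by apply: integrable_sum => // i _; exact: integrable_sum.
rewrite integral_sum//; last by move=> i; exact: integrable_sum.
have /fineK Bf := integrable_fin_num measurableT ib2.
have /fineK Sf := integrable_fin_num measurableT (ihi2 (Ordinal n0)).
rewrite integral_sample_sqr in Sf; rewrite -Bf -Sf.
set S := fine _; set B := fine _.
have row i : (\int[mu]_w \sum_(j < n) (h (X w, Y i w) * h (X w, Y j w))%:E =
   (S + (n%:R - 1) * B)%:E)%E.
  rewrite integral_sum// (bigD1 i)//=.
  under eq_integral do rewrite -expr2.
  rewrite integral_sample_sqr -Sf.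
  under eq_bigr => j ji do rewrite integral_sample_prod 1?eq_sym// -Bf.
  rewrite sumEFin -EFinD sumr_const cardC1 card_ord -[X in _ + X]mulr_natl.
  by rewrite -subn1 natrB.
under eq_bigr do rewrite row.
rewrite sumEFin sumr_const card_ord -[_ *+ _]mulr_natl -!EFinM -EFinD; congr EFin.
by field; rewrite pnatr_eq0 -lt0n.
Qed.

End sample_mean.

(** * From the two variance tests to a second moment *)

(** Pythagoras for the component of [g] along [a], with the squared length of
    that component expanded around [dotp a a], as the inner product test
    measures it.  For [a = 0] all the divisions by [0] give [0], and the
    identity still holds. *)
Lemma dotp_decomposition (R : realType) (d : nat) (g a : 'rV[R]_d) :
  dotp g g + dotp a a =
  dotp (g - (dotp g a / dotp a a) *: a) (g - (dotp g a / dotp a a) *: a)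
  + (dotp a a)^-1 * (dotp g a - dotp a a) ^+ 2 + 2 * dotp g a.
Proof.
have [a0|a0] := eqVneq (dotp a a) 0.
  have -> : a = 0 by exact: dotp_eq0.
  have d0 v : dotp v 0 = 0 :> R by rewrite /dotp trmx0 mulmx0 mxE.
  by rewrite scaler0 subr0 !d0 invr0 mul0r mulr0 !addr0.
set c := _ / _.
rewrite dotpDl !dotpDr (dotpC (- _) g) (dotpC (- _) (- _)) !dotpNr.
rewrite (dotpC (- _)) dotpNr !dotpZr !dotpZl /c.
by field.
Qed.

Section sample_moments.
Context (R : realType) (d : nat) d3 (D : measurableType d3)
  (P : probability D R) (g : D -> 'rV[R]_d) (a : 'rV[R]_d).
Hypothesis mg : forall j, measurable_fun setT (fun y => g y 0 j).
Hypothesis ga : forall j, (\int[P]_y (g y 0 j)%:E)%E = (a 0 j)%:E.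
Hypothesis g2 : (\int[P]_y (dotp (g y) (g y))%:E < +oo)%E.

Lemma integrable_coord j : P.-integrable setT (fun y => (g y 0 j)%:E).
Proof.
under eq_fun do rewrite -[g _ _ _]mulr1.
apply: integrable_prod_sqr => //.
- apply/integrableP; split.
    by apply/measurable_EFinP; exact: measurable_funX.
  apply: le_lt_trans g2; apply: ge0_le_integral => //.
  + apply: measurableT_comp => //; apply/measurable_EFinP.
    exact: measurable_funX.
  + by apply/measurable_EFinP; exact: measurable_dotp.
  + move=> y _; rewrite gee0_abs ?lee_fin ?sqr_ge0//; exact: sqr_coord_le_dotp.
- rewrite expr1n.
  exact: finite_measure_integrable_cst.
Qed.

(** The mean of [dotp_decomposition]: as [g] has mean [a], the last term
    averages to twice [dotp a a], and the two others are what the tests bound. *)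
Lemma second_moment_le (n : nat) (theta nu : R) :
  (\int[P]_y ((dotp (g y) a - dotp a a) ^+ 2)%:E <=
     (n%:R * (theta ^+ 2 * dotp a a ^+ 2))%:E)%E ->
  (\int[P]_y (dotp (g y - (dotp (g y) a / dotp a a) *: a)
                   (g y - (dotp (g y) a / dotp a a) *: a))%:E <=
     (n%:R * (nu ^+ 2 * dotp a a))%:E)%E ->
  (\int[P]_y (dotp (g y) (g y))%:E <=
     ((1 + n%:R * (theta ^+ 2 + nu ^+ 2)) * dotp a a)%:E)%E.
Proof.
move=> ip orth.
set N := dotp a a; have N0 : 0 <= N by exact: dotp_ge0.
pose O y := dotp (g y - (dotp (g y) a / N) *: a) (g y - (dotp (g y) a / N) *: a).
pose V y := (dotp (g y) a - N) ^+ 2.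
have mga : measurable_fun setT (fun y => dotp (g y) a) by exact: measurable_dotp.
have mO : measurable_fun setT O.
  apply: measurable_dotp => j.
    under eq_fun do rewrite !mxE.
    apply: measurable_funB => //; apply: measurable_funM => //.
    exact: measurable_funM.
  under eq_fun do rewrite !mxE.
  apply: measurable_funB => //; apply: measurable_funM => //.
  exact: measurable_funM.
have mV : measurable_fun setT V.
  by apply: measurable_funX; exact: measurable_funB.
have iga : P.-integrable setT (fun y => (dotp (g y) a)%:E).
  rewrite (_ : (fun y => _) =
      (fun y => \sum_(j < d) ((a 0 j)%:E * (g y 0 j)%:E)%E)).
    apply: integrable_sum => // j _; apply: integrableZl => //.
    exact: integrable_coord.
  apply/funext => y; rewrite dotpE -sumEFin.
  by apply: eq_bigr => j _; rewrite -EFinM mulrC.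
have Ega : (\int[P]_y (dotp (g y) a)%:E)%E = N%:E.
  under eq_integral do rewrite dotpE -sumEFin.
  rewrite integral_sum//; last first.
    move=> j; under eq_fun do rewrite mulrC EFinM.
    by apply: integrableZl => //; exact: integrable_coord.
  rewrite /N dotpE -sumEFin; apply: eq_bigr => j _.
  under eq_integral do rewrite mulrC EFinM.
  by rewrite integralZl//; [rewrite ga -EFinM | exact: integrable_coord].
have igg : P.-integrable setT (fun y => (dotp (g y) (g y))%:E).
  apply/integrableP; split.
    by apply/measurable_EFinP; exact: measurable_dotp.
  by under eq_integral do rewrite gee0_abs ?lee_fin ?dotp_ge0//.
have mfin := fineK (integrable_fin_num measurableT igg).
have key : ((\int[P]_y (O y)%:E) + (N^-1)%:E * (\int[P]_y (V y)%:E) =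
   \int[P]_y (dotp (g y) (g y))%:E - N%:E)%E.
  rewrite -ge0_integralZl//; last 3 first.
  - exact/measurable_EFinP.
  - by move=> y _; rewrite lee_fin sqr_ge0.
  - by rewrite lee_fin invr_ge0.
  rewrite -ge0_integralD//; last 4 first.
  - by move=> y _; rewrite lee_fin dotp_ge0.
  - exact/measurable_EFinP.
  - by move=> y _; rewrite -EFinM lee_fin mulr_ge0 ?invr_ge0 ?sqr_ge0.
  - by apply/measurable_EFinP; exact: measurable_funM.
  transitivity (\int[P]_y ((dotp (g y) (g y))%:E +
      (N%:E - 2%:E * (dotp (g y) a)%:E)))%E.
    apply: eq_integral => y _; rewrite -!EFinM -EFinB -!EFinD; congr EFin.
    have := dotp_decomposition (g y) a; rewrite -/N -/(O y) -/(V y); lra.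
  have i1 : P.-integrable setT (fun y => 2%:E * (dotp (g y) a)%:E)%E.
    exact: integrableZl.
  have i2 : P.-integrable setT (fun=> N%:E).
    exact: finite_measure_integrable_cst.
  have IN : (\int[P]__ N%:E = N%:E)%E.
    by rewrite integral_cst//= probability_setT mule1.
  rewrite integralD//; last exact: integrableB.
  rewrite (integralB _ i2 i1)// IN integralZl// Ega -EFinM -EFinB; congr (_ + _)%E.
  by rewrite -EFinN; congr EFin; ring.
have h : (\int[P]_y (dotp (g y) (g y))%:E - N%:E <=
    (n%:R * (nu ^+ 2 * N))%:E + (N^-1 * (n%:R * (theta ^+ 2 * N ^+ 2)))%:E)%E.
  rewrite -key; apply: leeD => //.
  by rewrite [leRHS]EFinM lee_wpmul2l// lee_fin invr_ge0.
move: h; rewrite -mfin -EFinB -EFinD !lee_fin => h.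
have [N00|N00] := eqVneq N 0.
  by move: h; rewrite N00; lra.
have e : N^-1 * (n%:R * (theta ^+ 2 * N ^+ 2)) = n%:R * (theta ^+ 2 * N) by field.
by rewrite e in h; lra.
Qed.

End sample_moments.

(** * One iteration at a fixed sample size *)

Section one_step.
Context (R : realType) (d : nat) d1 d2 d3 (Omega : measurableType d1)
  (T : measurableType d2) (D : measurableType d3)
  (mu : {finite_measure set Omega -> \bar R}) (P : probability D R)
  (f : 'rV[R]_d -> D -> R) (F : 'rV[R]_d -> R) (L Fmin c alpha : R)
  (X : Omega -> T) (u : T -> 'rV[R]_d) (n : nat) (Y : 'I_n -> Omega -> D).
Hypothesis f_diff : forall xi v, differentiable (f^~ xi) v.
Hypothesis f_meas : forall v, measurable_fun setT (f v).
Hypothesis f_unbiased : forall v j,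
  (\int[P]_xi (grad (f^~ xi) v 0 j)%:E)%E = (grad F v 0 j)%:E.
Hypothesis f_moment : forall v,
  (\int[P]_xi (dotp (grad (f^~ xi) v) (grad (f^~ xi) v))%:E < +oo)%E.
Hypothesis F_C2 : twice_continuously_differentiable F.
Hypothesis F_bounded_below : forall v, Fmin <= F v.
Hypothesis L_gt0 : 0 < L.
Hypothesis F_hessian : forall v, loewner_le (hessian F v) L%:M.
Hypothesis mX : measurable_fun setT X.
Hypothesis u_meas : forall j, measurable_fun setT (fun t => u t 0 j).
Hypothesis n0 : (0 < n)%N.
Hypothesis mY : forall i, measurable_fun setT (Y i).
Hypothesis indep1 : forall i, independent_of_law mu P X (Y i).
Hypothesis indep2 : forall i j, i != j ->
  independent_of_law mu P (fun w => (X w, Y j w)) (Y i).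
Hypothesis c_ge0 : 0 <= c.
Hypothesis alpha_gt0 : 0 < alpha.
Hypothesis alpha_le : alpha * ((1 + c) * L) <= 1.
Hypothesis second_moment : \forall w \ae mu,
  (\int[P]_xi (dotp (grad (f^~ xi) (u (X w))) (grad (f^~ xi) (u (X w))))%:E <=
   ((1 + n%:R * c) * dotp (grad F (u (X w))) (grad F (u (X w))))%:E)%E.

Let N (t : T) : R := dotp (grad F (u t)) (grad F (u t)).
Let next w := u (X w) - alpha *: (n%:R^-1 *: \sum_i grad (f^~ (Y i w)) (u (X w))).

Let F_cont : continuous F.
Proof. exact: (C2_continuous F_C2). Qed.

Let gradF_cont j := @C2_continuous_grad_coord R d F j F_C2.

Let h j (p : T * D) : R := grad (f^~ p.2) (u p.1) 0 j.
Let b j (t : T) : R := grad F (u t) 0 j.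

Let mh j : measurable_fun setT (h j).
Proof. exact: measurable_grad_coord. Qed.

Let mb j : measurable_fun setT (b j).
Proof. exact: (measurable_continuous_comp u_meas (@gradF_cont j)). Qed.

Let mN : measurable_fun setT (fun w => N (X w)).
Proof. by apply: measurable_dotp => j; apply: (measurableT_comp (mb j)). Qed.

Let mF : measurable_fun setT (fun w => F (u (X w))).
Proof.
exact: (measurableT_comp (measurable_continuous_comp u_meas F_cont) mX).
Qed.

Let hbar j := sample_mean X Y (h j).

Let next_coord w j : next w 0 j = u (X w) 0 j - alpha * hbar j w.
Proof. by rewrite /next !mxE summxE. Qed.

Let mhbar j : measurable_fun setT (hbar j).
Proof.
apply: measurable_funM => //; apply: measurable_sum => i.
by apply: (measurableT_comp (mh j)); exact: measurable_fun_pair.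
Qed.

Lemma measurable_averaged_update j : measurable_fun setT (fun w => next w 0 j).
Proof.
under eq_fun do rewrite next_coord.
apply: measurable_funB; first exact: (measurableT_comp (u_meas j)).
exact: measurable_funM.
Qed.

Let descent_next w : F (next w) <= F (u (X w))
  + (L / 2 * alpha ^+ 2 * \sum_j hbar j w ^+ 2
     - alpha * \sum_j b j (X w) * hbar j w).
Proof.
pose v := \row_j hbar j w.
have -> : next w = u (X w) + - alpha *: v.
  by apply/rowP => j; rewrite next_coord !mxE mulNr.
apply: le_trans (descent_inequality _ _ F_C2 F_hessian) _.
rewrite !dotpZr dotpZl -addrA lerD2l.
have -> : dotp (grad F (u (X w))) v = \sum_j b j (X w) * hbar j w.
  by rewrite dotpE; apply: eq_bigr => j _; rewrite [v 0 j]mxE.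
have -> : dotp v v = \sum_j hbar j w ^+ 2.
  by rewrite dotpE; apply: eq_bigr => j _; rewrite !mxE expr2.
lra.
Qed.

(** The expectation of [descent_next], where the sample mean has the moments
    computed above.  When [F - Fmin] is not integrable at the current point the
    right-hand side is infinite; otherwise [sqr_grad_le_gap] makes the squared
    gradient integrable, and the second moment bound does the same for every
    other term. *)
Lemma one_step_decrease :
  (\int[mu]_w (F (next w) - Fmin)%:E + \int[mu]_w (alpha / 2 * N (X w))%:E
   <= \int[mu]_w (F (u (X w)) - Fmin)%:E)%E.
Proof.
have [->|Gfin] := eqVneq (\int[mu]_w (F (u (X w)) - Fmin)%:E)%E +oo%E.
  by rewrite leey.
have mG : measurable_fun setT (fun w => F (u (X w)) - Fmin).
  exact: measurable_funB.
have iG : mu.-integrable setT (fun w => (F (u (X w)) - Fmin)%:E).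
  apply/integrableP; split; first exact/measurable_EFinP.
  under eq_integral do rewrite gee0_abs ?lee_fin ?subr_ge0//.
  by rewrite ltey.
have N0 t : 0 <= N t by exact: dotp_ge0.
have iN : mu.-integrable setT (fun w => (N (X w))%:E).
  apply: (le_integrable measurableT _ _ (integrableZl measurableT (2 * L) iG)).
    exact/measurable_EFinP.
  move=> w _; rewrite -EFinM !gee0_abs ?lee_fin//.
    by apply: sqr_grad_le_gap.
  by rewrite !mulr_ge0 ?subr_ge0// ltW.
have Nfin := fineK (integrable_fin_num measurableT iN).
pose m t := (\int[P]_xi (dotp (grad (f^~ xi) (u t)) (grad (f^~ xi) (u t)))%:E)%E.
have mgg : measurable_fun setT (fun p : T * D =>
    (dotp (grad (f^~ p.2) (u p.1)) (grad (f^~ p.2) (u p.1)))%:E).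
  by apply/measurable_EFinP; apply: measurable_dotp => j; exact: mh.
have mm : measurable_fun setT m.
  apply: (measurable_fun_fubini_tonelli_F _ mgg) => p.
  by rewrite lee_fin dotp_ge0.
have m0 t : (0 <= m t)%E by apply: integral_ge0 => y _; rewrite lee_fin dotp_ge0.
have Mle : (\int[mu]_w m (X w) <= (1 + n%:R * c)%:E * \int[mu]_w (N (X w))%:E)%E.
  rewrite -ge0_integralZl//; last 3 first.
  - exact/measurable_EFinP.
  - by move=> w _; rewrite lee_fin.
  - by rewrite lee_fin addr_ge0// mulr_ge0.
  apply: (ae_ge0_le_integral measurableT).
  - by move=> w _; exact: m0.
  - exact: (measurableT_comp mm mX).
  - by move=> w _; rewrite -EFinM lee_fin mulr_ge0// addr_ge0// mulr_ge0.
  - by apply: measurable_funeM; exact/measurable_EFinP.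
  - by apply: filterS second_moment => w hw _; rewrite -EFinM.
have M0 : (0 <= \int[mu]_w m (X w))%E.
  by apply: integral_ge0 => w _; exact: m0.
have Mlty : (\int[mu]_w m (X w) < +oo)%E.
  by apply: le_lt_trans Mle _; rewrite -Nfin -EFinM ltry.
have Mfin : (fine (\int[mu]_w m (X w)))%:E = (\int[mu]_w m (X w))%E.
  by rewrite fineK// ge0_fin_numE.
have mhy t j : measurable_fun setT (fun y => grad (f^~ y) (u t) 0 j).
  exact: (measurable_grad_coord_at (u t) f_diff f_meas j).
have ih j t : P.-integrable setT (fun y => (h j (t, y))%:E).
  exact: (integrable_coord (mhy t) (f_moment (u t))).
have mh2 j : measurable_fun setT (fun t => \int[P]_y (h j (t, y) ^+ 2)%:E)%E.
  apply: (measurable_fun_fubini_tonelli_F (fun p => (h j p ^+ 2)%:E)).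
    by apply/measurable_EFinP; exact: measurable_funX.
  by move=> p; rewrite lee_fin sqr_ge0.
have h2_ge0 j t : (0 <= \int[P]_y (h j (t, y) ^+ 2)%:E)%E.
  by apply: integral_ge0 => y _; rewrite lee_fin sqr_ge0.
have h2 j : (\int[mu]_w \int[P]_y (h j (X w, y) ^+ 2)%:E < +oo)%E.
  apply: le_lt_trans Mlty; apply: (ge0_le_integral mu measurableT).
  - by move=> w _; exact: h2_ge0.
  - exact: (measurableT_comp (mh2 j) mX).
  - exact: (measurableT_comp mm mX).
  - move=> w _; apply: (ge0_le_integral P measurableT).
    + by move=> y _; rewrite lee_fin sqr_ge0.
    + by apply/measurable_EFinP; apply: measurable_funX; exact: mhy.
    + by apply/measurable_EFinP; apply: measurable_dotp => i; exact: mhy.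
    + by move=> y _; rewrite lee_fin; exact: sqr_coord_le_dotp.
have b2 j : (\int[mu]_w (b j (X w) ^+ 2)%:E < +oo)%E.
  apply: le_lt_trans (integrable_lty measurableT iN).
  apply: (ge0_le_integral mu measurableT).
  - by move=> w _; rewrite lee_fin sqr_ge0.
  - apply/measurable_EFinP; apply: measurable_funX.
    exact: (measurableT_comp (mb j)).
  - exact/measurable_EFinP.
  - by move=> w _; rewrite lee_fin; exact: sqr_coord_le_dotp.
have hb j t : (\int[P]_y (h j (t, y))%:E)%E = (b j t)%:E.
  exact: (f_unbiased (u t) j).
have ibh j :=
  integrable_mean_sample_mean mX mY indep1 (mh j) (mb j) (h2 j) (b2 j).
have Ibh j := integral_mean_sample_mean mX mY indep1 (mh j) (mb j) (ih j)
  (hb j) (h2 j) (b2 j) n0.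
have ihh j := integrable_sample_mean_sqr mX mY indep1 (mh j) (h2 j).
have Ihh j := integral_sample_mean_sqr mX mY indep1 indep2 (mh j) (mb j) (ih j)
  (hb j) (h2 j) (b2 j) n0.
have iS : mu.-integrable setT (fun w => \sum_(j < d) (hbar j w ^+ 2)%:E)%E.
  by apply: integrable_sum => // j _; exact: ihh.
have iC : mu.-integrable setT (fun w => \sum_(j < d) (b j (X w) * hbar j w)%:E)%E.
  by apply: integrable_sum => // j _; exact: ibh.
have ib j : mu.-integrable setT (fun w => (b j (X w) ^+ 2)%:E).
  apply/integrableP; split.
    apply/measurable_EFinP; apply: measurable_funX.
    exact: (measurableT_comp (mb j)).
  by under eq_integral do rewrite gee0_abs ?lee_fin ?sqr_ge0//; exact: b2.
have sumb : (\sum_(j < d) \int[mu]_w (b j (X w) ^+ 2)%:E =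
    \int[mu]_w (N (X w))%:E)%E.
  rewrite -integral_sum//; apply: eq_integral => w _.
  by rewrite sumEFin /N dotpE; congr EFin; apply: eq_bigr => j _; rewrite expr2.
have sumh : (\sum_(j < d) \int[mu]_w \int[P]_y (h j (X w, y) ^+ 2)%:E =
    \int[mu]_w m (X w))%E.
  rewrite -ge0_integral_sum//; last first.
    by move=> j; exact: (measurableT_comp (mh2 j) mX).
  apply: eq_integral => w _; rewrite -ge0_integral_sum//; last 2 first.
  - by move=> j; apply/measurable_EFinP; apply: measurable_funX; exact: mhy.
  - by move=> j y _; rewrite lee_fin sqr_ge0.
  apply: eq_integral => y _; rewrite sumEFin dotpE; congr EFin.
have EC : (\int[mu]_w \sum_(j < d) (b j (X w) * hbar j w)%:E =
    \int[mu]_w (N (X w))%:E)%E.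
  by rewrite integral_sum// -sumb; apply: eq_bigr => j _; exact: Ibh.
have ES : (\int[mu]_w \sum_(j < d) (hbar j w ^+ 2)%:E =
   n%:R^-1%:E * \int[mu]_w m (X w) +
   (1 - n%:R^-1)%:E * \int[mu]_w (N (X w))%:E)%E.
  rewrite integral_sum// (eq_bigr _ (fun j _ => Ihh j)) big_split/= -sumh -sumb.
  rewrite !ge0_sume_distrr// => j _; apply: integral_ge0 => w _;
  by rewrite ?lee_fin ?sqr_ge0.
pose q w := ((F (u (X w)) - Fmin)%:E +
  ((L / 2 * alpha ^+ 2)%:E * \sum_(j < d) (hbar j w ^+ 2)%:E -
   alpha%:E * \sum_(j < d) (b j (X w) * hbar j w)%:E))%E.
have iSC := integrableB measurableT
  (integrableZl measurableT (L / 2 * alpha ^+ 2) iS)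
  (integrableZl measurableT alpha iC).
have iq : mu.-integrable setT q by exact: integrableD.
have mnext : measurable_fun setT (fun w => F (next w)).
  exact: (measurable_continuous_comp measurable_averaged_update F_cont).
have E1 : (\int[mu]_w (F (next w) - Fmin)%:E <= \int[mu]_w q w)%E.
  apply: (ge0_le_integral mu measurableT).
  - by move=> w _; rewrite lee_fin subr_ge0.
  - by apply/measurable_EFinP; exact: measurable_funB.
  - exact: measurable_int iq.
  - move=> w _; rewrite /q !sumEFin -!EFinM -EFinB -EFinD lee_fin.
    by have := descent_next w; lra.
have Gf := fineK (integrable_fin_num measurableT iG).
have E2 : (\int[mu]_w q w = \int[mu]_w (F (u (X w)) - Fmin)%:E +
  ((L / 2 * alpha ^+ 2)%:E * \int[mu]_w \sum_(j < d) (hbar j w ^+ 2)%:E -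
   alpha%:E * \int[mu]_w (N (X w))%:E))%E.
  rewrite (integralD measurableT iG iSC) integralB//; last 2 first.
  - exact: integrableZl.
  - exact: integrableZl.
  by rewrite (integralZl measurableT iS) (integralZl measurableT iC) EC.
have E3 : (\int[mu]_w (alpha / 2 * N (X w))%:E =
    (alpha / 2)%:E * \int[mu]_w (N (X w))%:E)%E.
  by under eq_integral do rewrite EFinM; exact: integralZl.
rewrite E3; apply: (le_trans (leeD E1 (lexx _))); rewrite E2 ES.
move: Mle; rewrite -Mfin -Nfin -Gf.
set M := fine (\int[mu]_w m (X w))%E; set IN := fine (\int[mu]_w (N (X w))%:E)%E.
set IG := fine _.
rewrite -!(EFinM, EFinD, EFinB) !lee_fin => Mle'.
have IN0 : 0 <= IN.
  by apply: fine_ge0; apply: integral_ge0 => w _; rewrite lee_fin.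
set S := n%:R^-1 * M + (1 - n%:R^-1) * IN.
have S_le : S <= (1 + c) * IN.
  rewrite /S -subr_ge0.
  have -> : (1 + c) * IN - (n%:R^-1 * M + (1 - n%:R^-1) * IN) =
     n%:R^-1 * ((1 + n%:R * c) * IN - M) by field; rewrite pnatr_eq0 -lt0n.
  by rewrite mulr_ge0// subr_ge0.
(* The steplength condition enters only here. *)
have c1S : L / 2 * alpha ^+ 2 * S <= alpha / 2 * IN.
  apply: (@le_trans _ _ (L / 2 * alpha ^+ 2 * ((1 + c) * IN))).
    by rewrite ler_wpM2l// mulr_ge0 ?sqr_ge0// divr_ge0// ltW.
  have -> : L / 2 * alpha ^+ 2 * ((1 + c) * IN) =
    alpha * ((1 + c) * L) * (alpha / 2 * IN) by field.
  by rewrite ler_piMl// mulr_ge0// divr_ge0// ltW.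
lra.
Qed.

End one_step.

(** * Random samples of random size *)

Section random_samples.
Context dO dD (Omega : measurableType dO) (D : measurableType dD).
Implicit Type s : Omega -> seq D.

Lemma draw_eventE s j B w :
  draw_event s j B w <-> (j < size (s w))%N /\ B (nth point (s w) j).
Proof.
split=> [[xi sj Bxi]|[js Bj]].
  by split; [rewrite -onthTE sj|rewrite (@onth_nth _ _ _ _ _ sj)].
exists (nth point (s w) j) => //.
move: js; rewrite -onthTE; case e: onth => [xi|//] _.
by rewrite (@onth_nth _ _ _ _ _ e).
Qed.

Lemma measurable_sample_size s n : random_sample s ->
  measurable [set w | size (s w) = n].
Proof.
move=> rs; have mlt j : measurable [set w | (j < size (s w))%N].
  rewrite (_ : [set _ | _] = draw_event s j setT); first exact: rs.
  by apply/seteqP; split => w; rewrite draw_eventE => //= -[].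
case: n => [|n].
  rewrite (_ : [set _ | _] = ~` [set w | (0 < size (s w))%N]).
    exact: measurableC.
  by apply/seteqP; split => w /=; [move=> ->|case: size].
rewrite (_ : [set _ | _] = [set w | (n < size (s w))%N] `\`
    [set w | (n.+1 < size (s w))%N]).
  exact: measurableD.
apply/seteqP; split => w /=; first by move=> ->; rewrite ltnn leqnn.
by move=> [h1 /negP]; rewrite -leqNgt => h2; apply/eqP; rewrite eqn_leq h2.
Qed.

(** Outside of the event that the [j]-th draw exists, the value is the default
    element, which accounts for the case distinction on [B point]. *)
Lemma measurable_nth_sample s j : random_sample s ->
  measurable_fun setT (fun w => nth point (s w) j).
Proof.
move=> rs _ B mB; rewrite setTI.
have [Bp|Bp] := pselect (B point).
  rewrite (_ : _ @^-1` _ = draw_event s j B `|` ~` draw_event s j setT).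
    by apply: measurableU; [exact: rs|apply: measurableC; exact: rs].
  apply/seteqP; split => w /=.
    move=> Bw; case: (ltnP j (size (s w))) => js.
      by left; apply/draw_eventE.
    by right=> /draw_eventE[]; rewrite ltnNge js.
  move=> [/draw_eventE[]//|nj].
  rewrite nth_default// leqNgt; apply/negP => js.
  by apply: nj; apply/draw_eventE.
rewrite (_ : _ @^-1` _ = draw_event s j B); first exact: rs.
apply/seteqP; split => w /=; last by move=> /draw_eventE[].
move=> Bw; apply/draw_eventE; split => //.
by rewrite ltnNge; apply/negP => js; rewrite nth_default in Bw.
Qed.

End random_samples.

Section restriction.
Context d (T : measurableType d) (R : realType).

Lemma ae_mrestr (mu : {finite_measure set T -> \bar R}) (A : set T)
    (mA : measurable A) (Q : T -> Prop) :
  (\forall w \ae mu, A w -> Q w) -> \forall w \ae mrestr mu mA, Q w.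
Proof.
move=> [N [mN N0 sN]]; exists (N `|` ~` A); split.
- by apply: measurableU => //; exact: measurableC.
- apply/eqP; rewrite eq_le measure_ge0 andbT -N0 /mrestr; apply: le_measure.
  + rewrite inE; apply: measurableI => //; apply: measurableU => //.
    exact: measurableC.
  + by rewrite inE.
  + by move=> w [[]].
- move=> w nQ; have [Aw|Aw] := pselect (A w); last by right.
  by left; apply: sN => h; exact/nQ/h.
Qed.

(** A measure is the sum of its restrictions to the pieces of a countable
    partition. *)
Lemma ge0_integral_partition (mu : {finite_measure set T -> \bar R})
    (A : nat -> set T) (mA : forall n, measurable (A n)) (phi : T -> \bar R) :
  trivIset setT A -> \bigcup_n A n = setT ->
  measurable_fun setT phi -> (forall w, 0 <= phi w)%E ->
  (\int[mu]_w phi w = \sum_(0 <= n <oo) \int[mrestr mu (mA n)]_w phi w)%E.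
Proof.
move=> tA UA mphi phi0.
rewrite -(@ge0_integral_measure_series _ _ _ (fun n => mrestr mu (mA n)) setT
  measurableT phi)//.
apply: eq_measure_integral => B mB _; rewrite /mseries/= /mrestr.
rewrite -[in LHS](setIT B) -UA setI_bigcupr.
apply: measure_semi_bigcup => //.
- by move=> n; exact: measurableI.
- exact: trivIset_setIl.
- by rewrite -setI_bigcupr UA setIT.
Qed.

End restriction.

Section iid.
Context (R : realType) dO dD (Omega : measurableType dO) (D : measurableType dD)
  (Pr : probability Omega R) (P : probability D R) (G : set (set Omega))
  (s : Omega -> seq D) (n : nat).
Hypothesis rs : random_sample s.
Hypothesis sub : <<s G >> `<=` measurable.
Hypothesis iid : iid_given_size Pr P <<s G>> s.

(* [X] is the identity: seen in [T], an outcome is only known through the events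
   in the sigma-algebra generated by [G]. *)
Let T : measurableType _ := g_sigma_algebraType G.
Let X : Omega -> T := id.
Let mun := mrestr Pr (measurable_sample_size n rs).
Let Y (i : 'I_n) w := nth point (s w) i.

Lemma measurable_history_id : measurable_fun setT X.
Proof. by move=> _ A mA; rewrite setTI; exact: sub. Qed.

(** On the event that the size is [n], [draw_event s j B] says that the [j]-th
    entry lies in [B], so the default value of [nth] is never reached. *)
Lemma iid_restr (A : set T) (B : 'I_n -> set D) : measurable A ->
  (forall j, measurable (B j)) ->
  (mun (X @^-1` A `&` \bigcap_(j in [set: 'I_n]) Y j @^-1` B j) =
   mun (X @^-1` A) * \prod_j P (B j))%E.
Proof.
move=> mA mB; rewrite -(iid mA mB) /mun /mrestr; congr (Pr _).
apply/seteqP; split => w /=.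
  move=> [[Aw Bw] sn]; split => // j _; apply/draw_eventE; rewrite sn.
  by split => //; exact: Bw.
move=> [[Aw sn] Bw]; split => //; split => // j _.
by have /draw_eventE[] := Bw j I.
Qed.

Lemma sample_independent i : independent_of_law mun P X (Y i).
Proof.
move=> A B mA mB.
have := @iid_restr A (fun j => if j == i then B else setT) mA.
rewrite (bigD1 i)//= eqxx big1 ?mule1; last first.
  by move=> j /negbTE ->; exact: probability_setT.
move=> <-; last by move=> j; case: ifP.
congr (mun _); congr (_ `&` _); apply/seteqP; split => w /=.
  by move=> Bw j _; case: eqP => [->|].
by move=> /(_ i I); rewrite eqxx.
Qed.

Lemma sample_pair_independent i j : i != j ->
  independent_of_law mun P (fun w => (X w, Y j w)) (Y i).
Proof.
move=> ij; apply: independent_of_law_pair.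
- exact: measurable_history_id.
- exact: measurable_nth_sample.
- exact: measurable_nth_sample.
move=> A B C mA mB mC.
have := @iid_restr A
  (fun l => if l == i then B else if l == j then C else setT) mA.
have ji : (j == i) = false by rewrite eq_sym; exact: negbTE.
rewrite (bigD1 i)//= (bigD1 j)/= ?ji// !eqxx.
rewrite big1 ?mule1; last first.
  by move=> l /andP[/negbTE -> /negbTE ->]; exact: probability_setT.
rewrite muleA => <-; last by move=> l; case: ifP => //; case: ifP.
rewrite -setIA; congr (mun _); congr (_ `&` _); apply/seteqP; split => w /=.
  by move=> [Bw Cw] l _; case: eqP => [->//|_]; case: eqP => [->|].
move=> h; split; first by have := h i I; rewrite eqxx.
by have := h j I; rewrite ji eqxx.
Qed.

End iid.

(** * The expected decrease in one iteration *)

Lemma sample_grad_nth (R : realType) (d : nat) dD (D : measurableType dD)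
    (f : 'rV[R]_d -> D -> R) (s : seq D) (v : 'rV[R]_d) :
  sample_grad f s v =
  (size s)%:R^-1 *: \sum_(i < size s) grad (f^~ (nth point s i)) v.
Proof. by rewrite /sample_grad (big_nth point) big_mkord. Qed.

(** For each value of the sample size this is a measurable function, and the
    size takes countably many values. *)
Lemma measurable_sgd_update (R : realType) (d : nat) dE dD
    (E : measurableType dE) (D : measurableType dD)
    (f : 'rV[R]_d -> D -> R) (alpha : R) (s : E -> seq D) (x : E -> 'rV[R]_d) :
  (forall xi v, differentiable (f^~ xi) v) ->
  (forall v, measurable_fun setT (f v)) ->
  random_sample s ->
  (forall j, measurable_fun setT (fun w => x w 0 j)) ->
  forall j, measurable_fun setT
    (fun w => (x w - alpha *: sample_grad f (s w) (x w)) 0 j).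
Proof.
move=> df mf rs mx j.
under eq_fun do rewrite sample_grad_nth.
apply: (@measurable_fun_countable_select _ _ E R nat (fun w => size (s w))
  (fun n w => (x w - alpha *: (n%:R^-1 *:
     \sum_(i < n) grad (f^~ (nth point (s w) i)) (x w))) 0 j)).
  by move=> n; exact: measurable_sample_size.
move=> n; apply: (@measurable_averaged_update R d _ _ _ E E D f alpha id x n
  (fun i w => nth point (s w) i)) => //.
by move=> i; exact: measurable_nth_sample.
Qed.

Lemma second_moment_of_tests (R : realType) (d : nat) dD (D : measurableType dD)
    (P : probability D R) (f : 'rV[R]_d -> D -> R) (F : 'rV[R]_d -> R)
    (theta nu : R) (v : 'rV[R]_d) (n : nat) :
  (forall j, measurable_fun setT (fun xi => grad (f^~ xi) v 0 j)) ->
  (forall j, (\int[P]_xi (grad (f^~ xi) v 0 j)%:E)%E = (grad F v 0 j)%:E) ->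
  (\int[P]_xi (dotp (grad (f^~ xi) v) (grad (f^~ xi) v))%:E < +oo)%E ->
  (0 < n)%N ->
  inner_product_test P f F theta v n -> orthogonality_test P f F nu v n ->
  (\int[P]_xi (dotp (grad (f^~ xi) v) (grad (f^~ xi) v))%:E <=
   ((1 + n%:R * (theta ^+ 2 + nu ^+ 2)) * dotp (grad F v) (grad F v))%:E)%E.
Proof.
move=> mg ug mom n0.
have n0R : 0 < n%:R :> R by rewrite ltr0n.
rewrite /inner_product_test /orthogonality_test unlock inver gt_eqF//.
rewrite !lee_pdivrMr// -!EFinM => ip orth.
apply: second_moment_le => //.
- move: ip; rewrite (exprM _ 2 2) l2norm2 (mulrC (theta ^+ 2 * _)).
  apply: le_trans.
  by rewrite le_eqVlt; apply/orP; left; apply/eqP/eq_integral.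
- move: orth; rewrite l2norm2 (mulrC (nu ^+ 2 * _)); apply: le_trans.
  rewrite le_eqVlt; apply/orP; left; apply/eqP/eq_integral => y _.
  by rewrite l2norm2.
Qed.

Section full_step.
Context (R : realType) (d : nat) dO dD (Omega : measurableType dO)
  (D : measurableType dD) (Pr : probability Omega R) (P : probability D R)
  (f : 'rV[R]_d -> D -> R) (F : 'rV[R]_d -> R)
  (L Fmin alpha theta nu : R)
  (G : set (set Omega)) (s : Omega -> seq D) (x : Omega -> 'rV[R]_d).
Hypothesis f_diff : forall xi v, differentiable (f^~ xi) v.
Hypothesis f_meas : forall v, measurable_fun setT (f v).
Hypothesis f_unbiased : forall v j,
  (\int[P]_xi (grad (f^~ xi) v 0 j)%:E)%E = (grad F v 0 j)%:E.
Hypothesis f_moment : forall v,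
  (\int[P]_xi (dotp (grad (f^~ xi) v) (grad (f^~ xi) v))%:E < +oo)%E.
Hypothesis F_C2 : twice_continuously_differentiable F.
Hypothesis F_bounded_below : forall v, Fmin <= F v.
Hypothesis L_gt0 : 0 < L.
Hypothesis F_hessian : forall v, loewner_le (hessian F v) L%:M.
Hypothesis alpha_gt0 : 0 < alpha.
Hypothesis alpha_le : alpha <= 1 / ((1 + theta ^+ 2 + nu ^+ 2) * L).
Hypothesis G_meas : <<s G >> `<=` measurable.
Hypothesis x_meas : forall j,
  measurable_fun setT ((fun w => x w 0 j) : g_sigma_algebraType G -> R).
Hypothesis s_random : random_sample s.
Hypothesis s_nonempty : forall w, (0 < size (s w))%N.
Hypothesis s_iid : iid_given_size Pr P <<s G>> s.
Hypothesis s_ip : \forall w \ae Pr,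
  inner_product_test P f F theta (x w) (size (s w)).
Hypothesis s_orth : \forall w \ae Pr,
  orthogonality_test P f F nu (x w) (size (s w)).

Lemma measurable_history_fun (g : Omega -> R) :
  measurable_fun setT (g : g_sigma_algebraType G -> R) -> measurable_fun setT g.
Proof.
move=> mg _ A mA; rewrite setTI; apply: G_meas.
by rewrite -[_ @^-1` _]setTI; exact: mg.
Qed.

(** The events where the sample has a given size partition the space, and the
    inequality of [one_step_decrease] holds for the restriction to each of
    them. *)
Lemma expected_decrease :
  (\int[Pr]_w (F (x w - alpha *: sample_grad f (s w) (x w)) - Fmin)%:E
   + (alpha / 2)%:E * \int[Pr]_w (dotp (grad F (x w)) (grad F (x w)))%:E
   <= \int[Pr]_w (F (x w) - Fmin)%:E)%E.
Proof.
pose A n := [set w | size (s w) = n].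
have mA n : measurable (A n) by exact: measurable_sample_size.
have tA : trivIset setT A.
  apply/trivIsetP => i j _ _ ij; apply/seteqP; split => // w [/= ei ej].
  by move: ij; rewrite -ei -ej eqxx.
have UA : \bigcup_n A n = setT.
  by apply/seteqP; split => // w _; exists (size (s w)).
have mx j : measurable_fun setT (fun w => x w 0 j).
  exact: measurable_history_fun.
have mnx := measurable_sgd_update alpha f_diff f_meas s_random mx.
have F_cont := C2_continuous F_C2.
have gradF_cont j := @C2_continuous_grad_coord R d F j F_C2.
have mFn : measurable_fun setT
    (fun w => F (x w - alpha *: sample_grad f (s w) (x w)) - Fmin).
  by apply: measurable_funB => //; exact: (measurable_continuous_comp mnx F_cont).
have mFx : measurable_fun setT (fun w => F (x w) - Fmin).
  by apply: measurable_funB => //; exact: (measurable_continuous_comp mx F_cont).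
have mNx : measurable_fun setT (fun w => dotp (grad F (x w)) (grad F (x w))).
  apply: measurable_dotp => j;
  exact: (measurable_continuous_comp mx (gradF_cont j)).
have a20 : 0 <= alpha / 2 by rewrite divr_ge0// ltW.
rewrite -ge0_integralZl//; last 2 first.
- exact/measurable_EFinP.
- by move=> w _; rewrite lee_fin dotp_ge0.
under [X in (_ + X)%E]eq_integral do rewrite -EFinM.
rewrite !(ge0_integral_partition Pr mA tA UA); last 6 first.
- exact/measurable_EFinP.
- by move=> w; rewrite lee_fin subr_ge0.
- by apply/measurable_EFinP; exact: measurable_funM.
- by move=> w; rewrite lee_fin mulr_ge0// dotp_ge0.
- exact/measurable_EFinP.
- by move=> w; rewrite lee_fin subr_ge0.
rewrite -nneseriesD; last 2 first.
- by move=> n _ _; apply: integral_ge0 => w _; rewrite lee_fin subr_ge0.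
- move=> n _ _; apply: integral_ge0 => w _.
  by rewrite lee_fin mulr_ge0// dotp_ge0.
apply: lee_nneseries => [n _ _|n _].
  apply: adde_ge0; apply: integral_ge0 => w _; rewrite lee_fin ?subr_ge0//.
  by rewrite mulr_ge0// dotp_ge0.
pose mun := mrestr Pr (mA n).
have [n0|n0] := posnP n.
  have A0 : A n = set0.
    by apply/seteqP; split => // w /= sn; have := s_nonempty w; rewrite sn n0.
  have int0 phi : (\int[mun]_w phi w = 0)%E.
    rewrite (eq_measure_integral mzero) ?integral_measure_zero// => B mB _.
    transitivity (Pr (B `&` A n)); first by [].
    by rewrite A0 setI0 measure0.
  by rewrite !int0 adde0.
have -> : (\int[mun]_w (F (x w - alpha *: sample_grad f (s w) (x w)) - Fmin)%:E =
  \int[mun]_w (F (x w - alpha *: (n%:R^-1 *: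
    \sum_(i < n) grad (f^~ (nth point (s w) i)) (x w))) - Fmin)%:E)%E.
  apply: ge0_ae_eq_integral => //.
  - exact/measurable_EFinP.
  - apply/measurable_EFinP; apply: measurable_funB => //.
    apply: (measurable_continuous_comp _ F_cont).
    apply: (@measurable_averaged_update R d _ _ _ Omega Omega D f alpha id x n
       (fun i w => nth point (s w) i)) => //.
    by move=> i; exact: measurable_nth_sample.
  - by move=> w _; rewrite lee_fin subr_ge0.
  - by move=> w _; rewrite lee_fin subr_ge0.
  - apply: ae_mrestr; apply: aeW => w /= sn _.
    by rewrite sample_grad_nth sn.
apply: (@one_step_decrease R d _ _ _ Omega (g_sigma_algebraType G) D mun P f F
  L Fmin (theta ^+ 2 + nu ^+ 2) alpha id x n
  (fun i w => nth point (s w) i)) => //.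
- exact: measurable_history_id.
- by move=> i; exact: measurable_nth_sample.
- exact: sample_independent.
- exact: sample_pair_independent.
- by rewrite addr_ge0// sqr_ge0.
- by rewrite addrA -ler_pdivlMr// mulr_gt0// -addrA ltr_pwDl// addr_ge0// sqr_ge0.
- apply: ae_mrestr; near=> w => /= sn; rewrite -sn.
  apply: second_moment_of_tests => //.
  + by move=> j; exact: (measurable_grad_coord_at (x w) f_diff f_meas j).
  + by near: w.
  + by near: w.
Unshelve. all: by end_near.
Qed.

End full_step.

(** * Summation over the iterations *)

Section telescoping.
Context (R : realType) (v e : nat -> R) (a : R).
Hypothesis a_gt0 : 0 < a.
Hypothesis e_ge0 : forall k, 0 <= e k.
Hypothesis v_ge0 : forall k, 0 <= v k.
Hypothesis decrease : forall k, v k.+1 + a * e k <= v k.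

Lemma telescoping_sum K : \sum_(k < K) e k <= v 0%N / a.
Proof.
rewrite ler_pdivlMr// mulrC mulr_sumr.
suff : v K + \sum_(k < K) a * e k <= v 0%N by move=> h; have := v_ge0 K; lra.
elim: K => [|K ih]; first by rewrite big_ord0 addr0.
rewrite big_ord_recr/=; have := decrease K; lra.
Qed.

Lemma telescoping_cvg0 : e @ \oo --> 0.
Proof.
apply: cvg_series_cvg_0; apply: nondecreasing_is_cvgn.
  by apply/nondecreasing_seqP => n; rewrite seriesEord/= big_ord_recr/= lerDl.
exists (v 0%N / a) => _ [K _ <-]; rewrite seriesEord; exact: telescoping_sum.
Qed.

(** If all the terms exceeded this bound, then their sum would exceed
    [v 0 / a]. *)
Lemma telescoping_min T : (0 < T)%N ->
  exists k : 'I_T, e k <= v 0%N / (a * T%:R).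
Proof.
move=> T0; apply: contrapT => /forallNP h.
have : \sum_(k < T) v 0%N / (a * T%:R) < \sum_(k < T) e k.
  apply: ltr_sum; last by move=> k _; rewrite ltNge; exact/negP/h.
  by apply/hasP; exists (Ordinal T0) => //; rewrite mem_index_enum.
rewrite sumr_const card_ord -[_ *+ T]mulr_natl.
have -> : T%:R * (v 0%N / (a * T%:R)) = v 0%N / a.
  by field; rewrite pnatr_eq0 -lt0n T0 gt_eqF.
by rewrite ltNge telescoping_sum.
Qed.

End telescoping.

(** * Measurability of the iterates *)

Section histories.
Context (R : realType) (d : nat) dO dD (Omega : measurableType dO)
  (D : measurableType dD) (S : nat -> Omega -> seq D).

(** Generators of [history S k].  Having them by name gives access to the
    measurable structure carried by [g_sigma_algebraType]. *)
Definition past_draws k : set (set Omega) := [set A | exists i j B,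
  [/\ (i < k)%N, measurable B & A = draw_event (S i) j B]].

Lemma past_draws_measurable k : (forall i, random_sample (S i)) ->
  <<s past_draws k >> `<=` measurable.
Proof.
move=> rS; apply: smallest_sub; first exact: sigma_algebra_measurable.
by move=> _ [i [j [B [_ mB ->]]]]; exact: rS.
Qed.

Lemma past_draws_random_sample k :
  random_sample (S k : g_sigma_algebraType (past_draws k.+1) -> seq D).
Proof. by move=> j B mB; apply: sub_gen_smallest; exists k, j, B. Qed.

Lemma past_draws_mono k : <<s past_draws k >> `<=` <<s past_draws k.+1 >>.
Proof.
apply: sub_sigma_algebra2 => _ [i [j [B [ik mB ->]]]].
by exists i, j, B; split => //; exact: ltnW.
Qed.

Lemma measurable_iterates (f : 'rV[R]_d -> D -> R) (alpha : R)
    (x : nat -> Omega -> 'rV[R]_d) (x0 : 'rV[R]_d) :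
  (forall xi v, differentiable (f^~ xi) v) ->
  (forall v, measurable_fun setT (f v)) ->
  (forall w, x 0%N w = x0) ->
  (forall k w, x k.+1 w = x k w - alpha *: sample_grad f (S k w) (x k w)) ->
  forall k j, measurable_fun setT
    ((fun w => x k w 0 j) : g_sigma_algebraType (past_draws k) -> R).
Proof.
move=> df mf xi xs; elim => [|k ih] j.
  rewrite (_ : (fun w => _) = cst (x0 0 j)); first exact: measurable_cst.
  by apply/funext => w; rewrite xi.
rewrite (_ : (fun w => _) = fun w =>
    (x k w - alpha *: sample_grad f (S k w) (x k w)) 0 j); last first.
  by apply/funext => w; rewrite xs.
apply: (@measurable_sgd_update R d _ _ (g_sigma_algebraType (past_draws k.+1))
  D f alpha (S k) (x k)) => //; first exact: past_draws_random_sample.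
move=> l _ B mB; apply: past_draws_mono.
exact: (ih l measurableT B mB).
Qed.

End histories.

(** * The convergence theorem *)

Theorem theorem3p4 (R : realType) (d : nat)
    (* data (z, y) with distribution P *)
    (dZ dY : measure_display) (Z : measurableType dZ) (Y : measurableType dY)
    (P : probability (Z * Y)%type R)
    (f : 'rV[R]_d -> Z * Y -> R) (F : 'rV[R]_d -> R)
    (* underlying probability space, samples and iterates *)
    (dO : measure_display) (Omega : measurableType dO)
    (Pr : probability Omega R)
    (sample : nat -> Omega -> seq (Z * Y))
    (x : nat -> Omega -> 'rV[R]_d) (x0 : 'rV[R]_d)
    (L alpha theta nu Fmin : R)
    (* F is the expected risk *)
    (f_smooth : forall (xi : Z * Y) u, differentiable (f^~ xi) u)
    (f_integrable : forall u, P.-integrable setT (EFin \o f u))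
    (F_risk : forall u, (F u)%:E = 'E_P[f u]%E)
    (grad_unbiased : forall u (j : 'I_d),
      'E_P[fun xi => (grad (f^~ xi) u 0 j)%R]%E = (grad F u 0 j)%:E)
    (grad_second_moment : forall u,
      ('E_P[fun xi => (l2norm (grad (f^~ xi) u) ^+ 2)%R] < +oo)%E)
    (* assumptions on F *)
    (F_C2 : twice_continuously_differentiable F)
    (F_bounded_below : forall u, Fmin <= F u)
    (L_gt0 : 0 < L)
    (F_hessian : forall u, loewner_le (hessian F u) L%:M)
    (* sampling *)
    (sample_random : forall k, random_sample (sample k))
    (sample_nonempty : forall k w, (0 < size (sample k w))%N)
    (size_history : forall k, size_determined_by (history sample k) (sample k))
    (sample_iid : forall k, iid_given_size Pr P (history sample k) (sample k))
    (* iteration *)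
    (x_init : forall w, x 0%N w = x0)
    (x_step : forall k w,
      x k.+1 w = x k w - alpha *: sample_grad f (sample k w) (x k w))
    (* tests *)
    (theta_gt0 : 0 < theta) (nu_gt0 : 0 < nu)
    (sample_inner_product : forall k, \forall w \ae Pr,
      inner_product_test P f F theta (x k w) (size (sample k w)))
    (sample_orthogonality : forall k, \forall w \ae Pr,
      orthogonality_test P f F nu (x k w) (size (sample k w)))
    (* steplength *)
    (alpha_gt0 : 0 < alpha)
    (alpha_le : alpha <= 1 / ((1 + theta ^+ 2 + nu ^+ 2) * L)) :
  ((fun k => 'E_Pr[fun w => (l2norm (grad F (x k w)) ^+ 2)%R]%E)
     @ \oo --> 0%:E)
  /\
  forall T : nat, (0 < T)%N ->
    (\big[mine/+oo]_(k < T) 'E_Pr[fun w => (l2norm (grad F (x k w)) ^+ 2)%R]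
       <= (2 / (alpha * T%:R) * (F x0 - Fmin))%R%:E)%E.
Proof.
have f_meas u : measurable_fun setT (f u).
  by apply/measurable_EFinP; exact: measurable_int (f_integrable u).
have unb v j : (\int[P]_xi (grad (f^~ xi) v 0 j)%:E)%E = (grad F v 0 j)%:E.
  by have := grad_unbiased v j; rewrite unlock.
have mom v : (\int[P]_xi (dotp (grad (f^~ xi) v) (grad (f^~ xi) v))%:E < +oo)%E.
  have := grad_second_moment v; rewrite unlock; apply: le_lt_trans.
  rewrite le_eqVlt; apply/orP; left; apply/eqP/eq_integral => xi _.
  by rewrite l2norm2.
have xm := measurable_iterates f_smooth f_meas x_init x_step.
pose V k := (\int[Pr]_w (F (x k w) - Fmin)%:E)%E.
pose N k w := dotp (grad F (x k w)) (grad F (x k w)).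
pose E k := (\int[Pr]_w (N k w)%:E)%E.
have EE k : 'E_Pr[fun w => (l2norm (grad F (x k w)) ^+ 2)%R]%E = E k.
  by rewrite unlock; apply: eq_integral => w _; rewrite l2norm2.
have V0 k : (0 <= V k)%E.
  by apply: integral_ge0 => w _; rewrite lee_fin subr_ge0.
have E0 k : (0 <= E k)%E.
  by apply: integral_ge0 => w _; rewrite lee_fin dotp_ge0.
have a2 : 0 < alpha / 2 by rewrite divr_gt0.
have step k : (V k.+1 + (alpha / 2)%:E * E k <= V k)%E.
  have := @expected_decrease R d _ _ Omega (Z * Y)%type Pr P f F L Fmin alpha
    theta nu (past_draws sample k) (sample k) (x k) f_smooth f_meas unb mom
    F_C2 F_bounded_below L_gt0 F_hessian alpha_gt0 alpha_le
    (past_draws_measurable sample_random) (xm k) (sample_random k)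
    (sample_nonempty k) (sample_iid k) (sample_inner_product k)
    (sample_orthogonality k).
  apply: le_trans; rewrite le_eqVlt; apply/orP; left; apply/eqP.
  by congr (_ + _)%E; apply: eq_integral => w _; rewrite x_step.
have V0E : V 0%N = (F x0 - Fmin)%:E.
  rewrite /V; under eq_integral do rewrite x_init.
  by rewrite integral_cst//= probability_setT mule1.
have Vfin k : V k \is a fin_num.
  rewrite ge0_fin_numE//; elim: k => [|k ih]; first by rewrite V0E ltry.
  apply: le_lt_trans ih; apply: le_trans (step k).
  by rewrite leeDl// mule_ge0// lee_fin ltW.
have Efin k : E k \is a fin_num.
  rewrite ge0_fin_numE// ltey; apply/eqP => Ey.
  have := step k; rewrite Ey gt0_muley ?lte_fin// addey; last first.
    by rewrite -ltNye (lt_le_trans _ (V0 _)).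
  by rewrite leye_eq => /eqP Vy; have := Vfin k; rewrite Vy.
pose v k := fine (V k); pose e k := fine (E k).
have VE k : V k = (v k)%:E by rewrite fineK.
have EEe k : E k = (e k)%:E by rewrite fineK.
have v_ge0 k : 0 <= v k by rewrite fine_ge0.
have e_ge0 k : 0 <= e k by rewrite fine_ge0.
have dec k : v k.+1 + alpha / 2 * e k <= v k.
  by have := step k; rewrite !VE EEe -EFinM -EFinD lee_fin.
have v0E : v 0%N = F x0 - Fmin by rewrite /v V0E.
split.
  rewrite (_ : (fun k => _) = EFin \o e); last first.
    by apply/funext => k; rewrite EE EEe.
  apply: cvg_EFin; first by apply: nearW.
  exact: (telescoping_cvg0 a2 e_ge0 v_ge0 dec).
move=> T T0; have [k ek] := telescoping_min a2 v_ge0 dec T0.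
apply: (bigmin_inf k) => //.
rewrite EE EEe lee_fin; apply: le_trans ek _.
rewrite v0E le_eqVlt; apply/orP; left; apply/eqP.
by field; rewrite pnatr_eq0 -lt0n T0 gt_eqF.
Qed.
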